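(* Let $\mathscr{V}$ be a Hilbert $\mathscr{A}$-module over a $C^*$-algebra $\mathscr{A}$, and let $a\in\mathscr{A}$ and $x\in\mathscr{V}$. Then $$\Omega(xa+xa^* )\le 2\|a+a^*\|\,\Omega(x)\qquad\text{and}\qquad \Omega(xa-xa^* )\le 2\|a-a^*\|\,\Omega(x).$$
   Context: $\mathscr{A}$ is a nonzero (not necessarily unital) complex $C^*$-algebra. A Hilbert $\mathscr{A}$-module $\mathscr{V}$ is a right $\mathscr{A}$-module with an $\mathscr{A}$-valued inner product $\langle\cdot,\cdot\rangle$ that is $\mathbb{C}$-linear and $\mathscr{A}$-linear in the second variable, so that $\langle x, ya\rangle=\langle x,y\rangle a$, and that satisfies $\langle x,y\rangle^*=\langle y,x\rangle$ and $\langle x,x\rangle\ge 0$ with equality iff $x=0$. It is complete in the norm $\|x\|=\|\langle x,x\rangle\|^{1/2}$. $\mathscr{A}$ is a Hilbert module over itself with $\langle a,b\rangle=a^*b$. For Hilbert $\mathscr{A}$-modules $\mathscr{V},\mathscr{W}$, $\mathbb{B}(\mathscr{V},\mathscr{W})$ is the space of adjointable maps and $\mathbb{K}(\mathscr{V},\mathscr{W})$ is the closed linear span in it of the maps $\theta_{x,y}(z)=x\langle y,z\rangle$ ($x\in\mathscr{W}$, $y\in\mathscr{V}$); $\mathbb{K}(\mathscr{V})=\mathbb{K}(\mathscr{V},\mathscr{V})$. For $a\in\mathscr{A}$ let $T_a\in\mathbb{K}(\mathscr{A})$ be $T_a(b)=ab$. For $x\in\mathscr{V}$ let $r_x\in\mathbb{K}(\mathscr{A},\mathscr{V})$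 be $r_x(a)=xa$ and $l_x\in\mathbb{K}(\mathscr{V},\mathscr{A})$ be $l_x(y)=\langle x,y\rangle$, so $r_x^*=l_x$. The linking algebra of $\mathscr{V}$ is the $C^*$-algebra $\mathbb{L}(\mathscr{V})=\left\{\begin{bmatrix} T_a & l_y\\ r_x & T\end{bmatrix}: a\in\mathscr{A},\ x,y\in\mathscr{V},\ T\in\mathbb{K}(\mathscr{V})\right\}=\mathbb{K}(\mathscr{A}\oplus\mathscr{V})$, acting on $\mathscr{A}\oplus\mathscr{V}$ by matrix multiplication on column vectors, with the operator norm. $\mathcal{S}(\mathbb{L}(\mathscr{V}))$ is the set of states (positive linear functionals of norm $1$) of $\mathbb{L}(\mathscr{V})$. The numerical radius of $x\in\mathscr{V}$ is $\Omega(x)=\sup\left\{\left|\varphi\left(\begin{bmatrix}0&0\\ r_x&0\end{bmatrix}\right)\right|:\varphi\in\mathcal{S}(\mathbb{L}(\mathscr{V}))\right\}$. *)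

(* Defs.v *)
From HB Require Import structures.
From mathcomp Require Import all_boot all_order all_algebra.
From mathcomp Require Import complex.
From mathcomp Require Import all_classical all_reals all_analysis.

Set Implicit Arguments.
Unset Strict Implicit.
Unset Printing Implicit Defensive.
Import Order.TTheory GRing.Theory Num.Theory.
Local Open Scope classical_set_scope.
Local Open Scope ring_scope.

(* C*-algebras, not necessarily unital: MathComp rings all have a unit, so the
   multiplication is an explicit operation on a complex Banach space. *)
HB.mixin Record isCStarAlgebra (R : realType) A of CompleteNormedModule R[i] A
  := {
  cmul : A -> A -> A ;
  star : A -> A ;
  cmulA : forall a b c, cmul a (cmul b c) = cmul (cmul a b) c ;
  cmulDl : forall a b c, cmul (a + b) c = cmul a c + cmul b c ;
  cmulDr : forall a b c, cmul a (b + c) = cmul a b + cmul a c ;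
  cmulZl : forall (k : R[i]) a b, cmul (k *: a) b = k *: cmul a b ;
  cmulZr : forall (k : R[i]) a b, cmul a (k *: b) = k *: cmul a b ;
  starK : forall a, star (star a) = a ;
  starD : forall a b, star (a + b) = star a + star b ;
  starZ : forall (k : R[i]) a, star (k *: a) = conjc k *: star a ;
  starM : forall a b, star (cmul a b) = cmul (star b) (star a) ;
  cnormM : forall a b, `|cmul a b| <= `|a| * `|b| ;
  cnorm_star : forall a, `|cmul (star a) a| = `|a| ^+ 2
}.

#[short(type="cstarAlgType")]
HB.structure Definition CStarAlgebra (R : realType) :=
  {A of isCStarAlgebra R A & CompleteNormedModule R[i] A}.

(* The spectral description of positivity would need a unitization. *)
Definition positive (R : realType) (A : cstarAlgType R) : set A :=
  [set a | exists b : A, a = cmul (star b) b].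

(* The norm of the underlying Banach space is forced by [normV] to be the one
   induced by the inner product. *)
HB.mixin Record isHilbertModule (R : realType) (A : cstarAlgType R) V
    of CompleteNormedModule R[i] V := {
  act : V -> A -> V ;
  inner : V -> V -> A ;
  actA : forall x a b, act (act x a) b = act x (cmul a b) ;
  actDl : forall x y a, act (x + y) a = act x a + act y a ;
  actDr : forall x a b, act x (a + b) = act x a + act x b ;
  actZl : forall (k : R[i]) x a, act (k *: x) a = k *: act x a ;
  actZr : forall (k : R[i]) x a, act x (k *: a) = k *: act x a ;
  innerDr : forall x y z, inner x (y + z) = inner x y + inner x z ;
  innerZr : forall (k : R[i]) x y, inner x (k *: y) = k *: inner x y ;
  innerMr : forall x y a, inner x (act y a) = cmul (inner x y) a ;
  star_inner : forall x y, star (inner x y) = inner y x ;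
  inner_ge0 : forall x, positive (inner x x) ;
  inner_eq0 : forall x, inner x x = 0 <-> x = 0 ;
  normV : forall x, `|x| ^+ 2 = `|inner x x|
}.

#[short(type="hilbertModType")]
HB.structure Definition HilbertModule (R : realType) (A : cstarAlgType R) :=
  {V of isHilbertModule R A V & CompleteNormedModule R[i] V}.

(* Over [R[i]] the library's norms take their values in [R[i]] (they are
   nonnegative reals there); [rnorm] is the same norm with values in [R]. *)
Definition rnorm (R : realType) (V : normedZmodType R[i]) (x : V) : R :=
  complex.Re `|x|.

(* The supremum is taken in the extended reals, hence is +oo for an unbounded
   map. *)
Definition opnorm (R : realType) (U W : Type) (nU : U -> R) (nW : W -> R)
    (T : U -> W) : \bar R :=
  ereal_sup [set (nW (T u))%:E | u in [set u | nU u <= 1]].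

Section Operators.
Context (R : realType) (A : cstarAlgType R).

Definition adjointable (V W : hilbertModType A) (T : V -> W) : Prop :=
  exists T' : W -> V, forall x y, inner (T x) y = inner x (T' y).

Definition theta (V W : hilbertModType A) (x : W) (y : V) : V -> W :=
  fun z => act x (inner y z).

Definition span_theta (V W : hilbertModType A) : set (V -> W) :=
  [set F | exists (n : nat) (k : 'I_n -> R[i]) (x : 'I_n -> W) (y : 'I_n -> V),
     F = (fun z => \sum_(i < n) k i *: theta (x i) (y i) z)].

Definition compact_ops (V W : hilbertModType A) : set (V -> W) :=
  [set T : V -> W | adjointable T /\
     forall e : R, 0 < e -> exists2 F : V -> W, span_theta F &
       (opnorm (@rnorm R V) (@rnorm R W) (fun z => (T z - F z)%R) < e%:E)%E].

Variable V : hilbertModType A.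

Definition T_ (a : A) : A -> A := fun b => cmul a b.
Definition r_ (x : V) : A -> V := fun a => act x a.
Definition l_ (x : V) : V -> A := fun y => inner x y.

(* The Hilbert module A (+) V. The norm that the library puts on the product
   type is the max norm, which is not the one wanted here. *)
Definition dsinner (u v : A * V) : A :=
  cmul (star u.1) v.1 + inner u.2 v.2.
Definition dsnorm (u : A * V) : R := Num.sqrt (rnorm (dsinner u u)).

Definition block_op (S11 : A -> A) (S12 : V -> A) (S21 : A -> V) (S22 : V -> V)
    : A * V -> A * V :=
  fun u => (S11 u.1 + S12 u.2, S21 u.1 + S22 u.2).

Definition linking_algebra : set (A * V -> A * V) :=
  [set S | exists (a : A) (x y : V) (T : V -> V),
     compact_ops T /\ S = block_op (T_ a) (l_ y) (r_ x) T].

Definition ds_adjoint (S S' : A * V -> A * V) : Prop :=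
  forall u v, dsinner (S u) v = dsinner u (S' v).

(* A functional on the linking algebra is represented by a function on all maps
   of A (+) V; only its values on the linking algebra are constrained or used. *)
Definition linking_linear (phi : (A * V -> A * V) -> R[i]) : Prop :=
  forall (k : R[i]) (S T : A * V -> A * V),
    linking_algebra S -> linking_algebra T ->
    phi (fun u => k *: S u + T u) = k * phi S + phi T.

Definition linking_positive (phi : (A * V -> A * V) -> R[i]) : Prop :=
  forall S S' : A * V -> A * V,
    linking_algebra S -> linking_algebra S' -> ds_adjoint S S' ->
    0 <= phi (S' \o S).

Definition linking_fnorm (phi : (A * V -> A * V) -> R[i]) : \bar R :=
  ereal_sup [set (rnorm (phi S))%:E | S in
    [set S | linking_algebra S /\ (opnorm dsnorm dsnorm S <= 1)%E]].

Definition linking_states : set ((A * V -> A * V) -> R[i]) :=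
  [set phi | [/\ linking_linear phi, linking_positive phi
                & linking_fnorm phi = 1%E]].

(* [sup] is 0 on unbounded sets, but here the set is bounded: states have norm 1
   and the operator is bounded. *)
Definition Omega (x : V) : R :=
  sup [set rnorm (phi (block_op (fun=> 0) (fun=> 0) (r_ x) (fun=> 0)))
      | phi in linking_states].

End Operators.

(* Main.v *)
Require Import Defs.
From mathcomp Require Import all_boot all_order all_algebra.
From mathcomp Require Import complex.
From mathcomp Require Import all_classical all_reals all_analysis.
From mathcomp Require Import ring lra.

(** Let [B = diag(b, t)] on [A (+) V], with [t > |b|], and let [S_x] be the operator
    whose only entry is [r_x], in the lower left corner. For a state [phi] the
    functional [psi(S) = phi(star B . S . B)] is positive on the linking algebra, its
    norm is at most [|B|^2 <= t^2], and [star B . S_x . B = t S_(xb)]. Normalizing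
    [psi] to a state gives [t |phi(S_(xb))| = |psi(S_x)| <= t^2 Omega(x)], hence
    [Omega(xb) <= |b| Omega(x)]; take [b = a + star a] or [b = a - star a].

    The bound [|B| <= t] says that the norm is monotone on positive elements and that
    [star b . b <= t^2]. As the algebra need not have a unit,
    an operator [f] on [A] is called positive when [|t - f| <= t + o(1)] for large [t].
    Commutative arguments are carried out with real polynomials in one self-adjoint
    element: for [|y| < 1] they approximate a square root of [1 - y].
    Positivity of [h = star a . a] follows from polynomials [P], [Q] approximating
    [|h|] and its square root: with [v = P - h], the element [a v] satisfies
    [star (a v) . (a v) + (Q v)^2 ~ v (P^2 - h^2) ~ 0], which forces [v ~ 0]. *)

Set Implicit Arguments.
Unset Strict Implicit.
Unset Printing Implicit Defensive.
Import Order.TTheory GRing.Theory Num.Theory.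
Import numFieldNormedType.Exports.
Local Open Scope ring_scope.
Local Open Scope complex_scope.

(** * Norms with real values *)

Section Rnorm.
Context (R : realType).

Lemma rnormE (V : normedZmodType R[i]) (v : V) : `|v| = (rnorm v)%:C.
Proof. by rewrite /rnorm RRe_real ?normr_real. Qed.

Lemma rnorm_ge0 (V : normedZmodType R[i]) (v : V) : 0 <= rnorm v.
Proof. by rewrite -ler0c -rnormE. Qed.

Lemma rnorm0 (V : normedModType R[i]) : rnorm (0 : V) = 0.
Proof. by rewrite /rnorm normr0. Qed.

Lemma rnormN (V : normedModType R[i]) (v : V) : rnorm (- v) = rnorm v.
Proof. by rewrite /rnorm normrN. Qed.

Lemma rnormD (V : normedModType R[i]) (v w : V) :
  rnorm (v + w) <= rnorm v + rnorm w.
Proof. by rewrite -lecR rmorphD /= -!rnormE ler_normD. Qed.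

Lemma rnormZ (V : normedModType R[i]) (r : R) (v : V) :
  rnorm (r%:C *: v) = `|r| * rnorm v.
Proof.
apply: complexI; rewrite rmorphM /= -!rnormE normrZ rnormE; congr (_ * _).
by rewrite normc_def /= expr0n addr0 sqrtr_sqr.
Qed.

Lemma rnormM (z1 z2 : R[i]) : rnorm (z1 * z2) = rnorm z1 * rnorm z2.
Proof. by apply: complexI; rewrite rmorphM /= -!rnormE normrM. Qed.

Lemma rnorm_real (r : R) : rnorm r%:C = `|r|.
Proof. by rewrite /rnorm normc_def /= expr0n addr0 sqrtr_sqr. Qed.

End Rnorm.

(** * Real polynomials in an element of the algebra *)

Section CStarBasics.
Context (R : realType) (A : cstarAlgType R).
Implicit Types (a b c h : A) (p q : {poly R}).

Lemma rnorm_cmul a b : rnorm (cmul a b) <= rnorm a * rnorm b.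
Proof. by rewrite -lecR rmorphM /= -!rnormE cnormM. Qed.

Lemma rnorm_starM a : rnorm (cmul (star a) a) = rnorm a ^+ 2.
Proof. by apply: complexI; rewrite rmorphXn /= -!rnormE cnorm_star. Qed.

Lemma cmul0 a : cmul a 0 = 0.
Proof. by apply: (addrI (cmul a 0)); rewrite -cmulDr !addr0. Qed.

Lemma cmul0l a : cmul 0 a = 0.
Proof. by apply: (addrI (cmul 0 a)); rewrite -cmulDl !addr0. Qed.

Lemma star0 : star (0 : A) = 0.
Proof. by apply: (addrI (star 0)); rewrite -starD !addr0. Qed.

Lemma starN a : star (- a) = - star a.
Proof. by apply: (addrI (star a)); rewrite -starD !subrr star0. Qed.

Lemma cmulNr a b : cmul a (- b) = - cmul a b.
Proof. by apply: (addrI (cmul a b)); rewrite -cmulDr !subrr cmul0. Qed.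

Lemma cmulNl a b : cmul (- a) b = - cmul a b.
Proof. by apply: (addrI (cmul a b)); rewrite -cmulDl !subrr cmul0l. Qed.

Lemma starZr (r : R) a : star (r%:C *: a) = r%:C *: star a.
Proof. by rewrite starZ conjc_real. Qed.

Lemma rnorm_star a : rnorm (star a) = rnorm a.
Proof.
wlog suff: a / rnorm a <= rnorm (star a).
  by move=> le; apply/eqP; rewrite eq_le le -{2}(starK a) le.
have [/eqP a0|a0] := boolP (rnorm a == 0); first by rewrite a0 rnorm_ge0.
have := rnorm_cmul (star a) a; rewrite rnorm_starM expr2.
by rewrite ler_pM2r // lt_def a0 rnorm_ge0.
Qed.

(** The action of [p(h)] by left multiplication. As [A] need not have a unit, [p(h)] may exist only
    as an operator when [p] has a nonzero constant term. *)
Definition pact h p b : A := \sum_(i < size p) (p`_i)%:C *: iter i (cmul h) b.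

Lemma pact_widen h p b n : (size p <= n)%N ->
  pact h p b = \sum_(i < n) (p`_i)%:C *: iter i (cmul h) b.
Proof.
move=> le_pn; rewrite /pact (big_ord_widen _ (fun i => (p`_i)%:C *: iter i (cmul h) b) le_pn).
rewrite big_mkcond /=; apply: eq_bigr => i _.
by case: ltnP => // le_pi; rewrite nth_default // scale0r.
Qed.

Lemma pactD h p q b : pact h (p + q) b = pact h p b + pact h q b.
Proof.
set n := maxn (size p) (size q).
rewrite (@pact_widen h (p + q) b n) ?size_polyD // (@pact_widen h p b n) ?leq_maxl //.
rewrite (@pact_widen h q b n) ?leq_maxr // -big_split /=.
by apply: eq_bigr => i _; rewrite coefD rmorphD scalerDl.
Qed.

Lemma pactZ h (r : R) p b : pact h (r *: p) b = r%:C *: pact h p b.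
Proof.
rewrite (@pact_widen h (r *: p) b (size p)) ?size_scale_leq // scaler_sumr.
by apply: eq_bigr => i _; rewrite coefZ rmorphM scalerA.
Qed.

Lemma pactN h p b : pact h (- p) b = - pact h p b.
Proof. by rewrite -scaleN1r pactZ rmorphN1 scaleN1r. Qed.

Lemma pactB h p q b : pact h (p - q) b = pact h p b - pact h q b.
Proof. by rewrite pactD pactN. Qed.

Lemma pactC h (r : R) b : pact h r%:P b = r%:C *: b.
Proof. by rewrite (@pact_widen _ _ _ 1) ?size_polyC_leq1 // big_ord1 coefC. Qed.

Lemma pact1 h b : pact h 1 b = b.
Proof. by rewrite -polyC1 pactC rmorph1 scale1r. Qed.

Lemma pactMX h p b : pact h (p * 'X) b = pact h p (cmul h b).
Proof.
rewrite (@pact_widen _ _ _ (size p).+1); last first.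
  by apply: leq_trans (size_polyMleq _ _) _; rewrite size_polyX addn2.
rewrite big_ord_recl coefMX rmorph0 scale0r add0r.
by apply: eq_bigr => i _; rewrite coefMX /= -iterS iterSr.
Qed.

Lemma cmul_sumr a n (F : 'I_n -> A) :
  cmul a (\sum_(i < n) F i) = \sum_(i < n) cmul a (F i).
Proof.
by apply: (big_ind2 (fun x y => cmul a x = y)) => [|x1 x2 y1 y2 <- <-|];
  rewrite ?cmul0 ?cmulDr.
Qed.

(** The relation [h' c = c h] passes to all powers. Two cases matter: [h = h'] commuting with [c],
    and [h = star c . c], [h' = c . star c]. *)
Lemma pact_intertwine h h' c p b : (forall b', cmul h' (cmul c b') = cmul c (cmul h b')) ->
  pact h' p (cmul c b) = cmul c (pact h p b).
Proof.
move=> hc; rewrite cmul_sumr; apply: eq_bigr => i _; rewrite cmulZr; congr (_ *: _).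
by elim: (i : nat) => //= n ->.
Qed.

Lemma pactM h p q b : pact h (p * q) b = pact h p (pact h q b).
Proof.
elim/poly_ind: p q b => [|p c IH] q b.
  by rewrite mul0r -[RHS]addr0 /pact size_poly0 !big_ord0 addr0.
rewrite mulrDl !pactD pactMX -mulrA IH mul_polyC pactZ pactC; congr (_ + _).
rewrite -commr_polyX pactMX; congr (pact h p _).
exact: pact_intertwine.
Qed.

Lemma pactX h b : pact h 'X b = cmul h b.
Proof. by rewrite -['X]mul1r pactMX pact1. Qed.

(* [p(h)] has real coefficients, hence is self-adjoint when [h] is. *)
Lemma star_pact h p b c : star h = h ->
  cmul (star (pact h p b)) c = cmul (star b) (pact h p c).
Proof.
move=> hh; elim/poly_ind: p b c => [|p r IH] b c.
  by rewrite -[0]polyC0 !pactC !rmorph0 !scale0r star0 cmul0l cmul0.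
rewrite !pactD !pactMX !pactC starD cmulDl cmulDr IH starM hh starZr cmulZl cmulZr.
by rewrite -cmulA; congr (cmul _ _ + _); rewrite (@pact_intertwine h h).
Qed.

End CStarBasics.

(** * Positive operators *)

Section Bounds.
Context (R : realType) (A : cstarAlgType R).
Implicit Types (a b c h : A) (p q : {poly R}) (f g : A -> A) (M N e t d : R).

Definition obound f M := forall b, rnorm (f b) <= M * rnorm b.

(** For self-adjoint [f] the bound places the spectrum in [[-e, 2t + e]], so it is nonnegative as
    [e] is arbitrary. The slack [e] makes the notion stable under norm limits. *)
Definition opos f :=
  forall e, 0 < e -> exists2 t, 0 < t & obound (fun b => t%:C *: b - f b) (t + e).

Local Notation pbound h p := (obound (pact h p)).
Local Notation ppos h p := (opos (pact h p)).

Lemma obound_le f M N : M <= N -> obound f M -> obound f N.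
Proof.
by move=> MN fM b; apply: le_trans (fM b) _; rewrite ler_wpM2r ?rnorm_ge0.
Qed.

Lemma eq_obound f g M : f =1 g -> obound f M -> obound g M.
Proof. by move=> fg fM b; rewrite -fg. Qed.

Lemma oboundD f g M N : obound f M -> obound g N -> obound (fun b => f b + g b) (M + N).
Proof.
by move=> fM gN b; rewrite mulrDl (le_trans (rnormD _ _)) // lerD.
Qed.

Lemma oboundN f M : obound f M -> obound (fun b => - f b) M.
Proof. by move=> fM b; rewrite rnormN. Qed.

Lemma obound_cmul a : obound (cmul a) (rnorm a).
Proof. exact: rnorm_cmul. Qed.

Lemma obound_lim f M : (forall e, 0 < e -> obound f (M + e)) -> obound f M.
Proof.
move=> fM b; apply/ler_addgt0Pr => e e0.
have n1 : 0 < rnorm b + 1 by rewrite ltr_wpDl ?rnorm_ge0.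
apply: le_trans (fM (e / (rnorm b + 1)) _ b) _; first by rewrite divr_gt0.
rewrite mulrDl lerD2l -mulrA ler_piMr ?(ltW e0) // mulrC ler_pdivrMr // mul1r.
by rewrite lerDl.
Qed.

Lemma eq_opos f g : f =1 g -> opos f -> opos g.
Proof. by move=> /funext->. Qed.

Lemma oposD f g : opos f -> opos g -> opos (fun b => f b + g b).
Proof.
move=> fp gp e e0; have e2 : 0 < e / 2 by rewrite divr_gt0.
have [t t0 ft] := fp _ e2; have [s s0 gs] := gp _ e2.
exists (t + s); first exact: addr_gt0.
apply: (@obound_le _ ((t + e / 2) + (s + e / 2))); first by lra.
by apply: eq_obound (oboundD ft gs) => b; rewrite rmorphD /= scalerDl opprD addrACA.
Qed.

Lemma opos_lim f :
  (forall d, 0 < d -> exists2 g, opos g & obound (fun b => f b - g b) d) -> opos f.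
Proof.
move=> fP e e0; have e2 : 0 < e / 2 by rewrite divr_gt0.
have [g gp fg] := fP _ e2; have [t t0 gt] := gp _ e2; exists t => //.
apply: (@obound_le _ ((t + e / 2) + e / 2)); first by lra.
by apply: eq_obound (oboundD gt (oboundN fg)) => b; rewrite opprB addrA subrK.
Qed.

Lemma oposZ f r : 0 < r -> opos f -> opos (fun b => r%:C *: f b).
Proof.
move=> r0 fp e e0; have er : 0 < e / r by rewrite divr_gt0.
have [t t0 ft] := fp _ er; exists (r * t); first exact: mulr_gt0.
move=> b; have -> : (r * t)%:C *: b - r%:C *: f b = r%:C *: (t%:C *: b - f b).
  by rewrite scalerBr scalerA rmorphM.
rewrite rnormZ gtr0_norm //; have -> : r * t + e = r * (t + e / r) by field; lra.
by rewrite -mulrA ler_pM2l.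
Qed.

Section Polynomials.
Variable h : A.

Lemma pboundD p q M N : pbound h p M -> pbound h q N -> pbound h (p + q) (M + N).
Proof. by move=> pM qN; apply: eq_obound (oboundD pM qN) => b; rewrite pactD. Qed.

Lemma pboundN p M : pbound h p M -> pbound h (- p) M.
Proof. by move=> pM; apply: eq_obound (oboundN pM) => b; rewrite pactN. Qed.

Lemma pboundB p q M N : pbound h p M -> pbound h q N -> pbound h (p - q) (M + N).
Proof. by move=> pM qN; apply: pboundD pM (pboundN qN). Qed.

Lemma pboundZ p M r : pbound h p M -> pbound h (r *: p) (`|r| * M).
Proof. by move=> pM b; rewrite pactZ rnormZ -mulrA ler_wpM2l. Qed.

Lemma pboundM p q M N : 0 <= M -> pbound h p M -> pbound h q N -> pbound h (p * q) (M * N).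
Proof.
by move=> M0 pM qN b; rewrite pactM -mulrA (le_trans (pM _)) // ler_wpM2l.
Qed.

Lemma pboundC r : pbound h r%:P `|r|.
Proof. by move=> b; rewrite pactC rnormZ. Qed.

Lemma pbound0 : pbound h 0 0.
Proof. by move=> b; rewrite -[X in pact h X]polyC0 pactC rmorph0 scale0r rnorm0 mul0r. Qed.

Lemma pbound1 : pbound h 1 1.
Proof. by move=> b; rewrite pact1 mul1r. Qed.

Lemma pboundX : pbound h 'X (rnorm h).
Proof. by move=> b; rewrite pactX rnorm_cmul. Qed.

Lemma pbound_exp p M n : 0 <= M -> pbound h p M -> pbound h (p ^+ n) (M ^+ n).
Proof.
move=> M0 pM; elim: n => [|n IH]; first by rewrite !expr0; apply: pbound1.
by rewrite !exprS; apply: pboundM.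
Qed.

Lemma pbound_sum n (F : 'I_n -> {poly R}) (M : 'I_n -> R) :
  (forall i, pbound h (F i) (M i)) -> pbound h (\sum_(i < n) F i) (\sum_(i < n) M i).
Proof.
move=> FM; apply: (big_ind2 (fun p M => pbound h p M)) => //.
- exact: pbound0.
- by move=> *; apply: pboundD.
Qed.

Lemma pbound_exists p : exists2 M, 0 < M & pbound h p M.
Proof.
elim/poly_ind: p => [|p r [M M0 pM]].
  by exists 1 => //; apply: (@obound_le _ 0) => //; apply: pbound0.
exists (M * rnorm h + `|r| + 1).
  by rewrite ltr_wpDl // addr_ge0 // mulr_ge0 ?rnorm_ge0 // ltW.
apply: (@obound_le _ (M * rnorm h + `|r|)); first by rewrite lerDl.
by apply: pboundD (pboundC r); apply: pboundM (ltW M0) pM pboundX.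
Qed.

Hypothesis hh : star h = h.

(* For commuting self-adjoint [x = p(h)] and [y = q(h)], [x] is the real part of
   the normal element [x + i y], whose squared norm is that of [x^2 + y^2]. *)
Lemma pbound_sumsq p q M : 0 <= M -> pbound h (p ^+ 2 + q ^+ 2) (M ^+ 2) -> pbound h p M.
Proof.
move=> M0 pqM b.
have bound (s : R) : s ^+ 2 = 1 ->
    rnorm (pact h p b + (s%:C * 'i) *: pact h q b) <= M * rnorm b.
  move=> s2; set u := _ + _.
  have kJ : (s%:C * 'i)^* = - (s%:C * 'i) 
    by apply/eqP; rewrite eq_complex /=; apply/andP; split; apply/eqP; ring.
  have kk : (s%:C * 'i) * (s%:C * 'i) = -1 :> R[i].
    by rewrite mulrACA -!expr2 -rmorphXn /= s2 sqr_i mul1r.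
  have uu : cmul (star u) u = cmul (star b) (pact h (p ^+ 2 + q ^+ 2) b).
    rewrite /u starD starZ !cmulDl !cmulDr !(cmulZl, cmulZr) !star_pact //.
    rewrite -!pactM scalerA (mulrC q p) pactD cmulDr addrACA.
    by rewrite kJ mulNr kk opprK scale1r scaleNr addrA subrK -!expr2.
  have : rnorm u ^+ 2 <= (M * rnorm b) ^+ 2.
    rewrite -rnorm_starM uu (le_trans (rnorm_cmul _ _)) // rnorm_star exprMn.
    by rewrite [leRHS]mulrC expr2 -mulrA ler_wpM2l ?rnorm_ge0 // mulrC.
  by rewrite ler_pXn2r ?nnegrE ?mulr_ge0 ?rnorm_ge0.
have b1 := bound 1 (expr1n _ _).
have /bound b2 : (-1) ^+ 2 = 1 :> R by rewrite sqrrN expr1n.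
(* Adding the bounds for [s = 1] and [s = -1] cancels the terms in [q] and leaves twice [p(h) b]. *)
have := le_trans (rnormD _ _) (lerD b1 b2).
rewrite rmorph1 rmorphN1 mulN1r scaleNr mul1r addrACA addrN addr0.
have -> : pact h p b + pact h p b = 2%:R%:C *: pact h p b by rewrite -mulr2n -scaler_nat rmorph_nat.
rewrite rnormZ ger0_norm //; lra.
Qed.

Lemma pbound_sqr p M : 0 <= M -> pbound h (p ^+ 2) (M ^+ 2) -> pbound h p M.
Proof.
move=> M0 pM; apply: (@pbound_sumsq p 0) => //.
by rewrite expr0n addr0.
Qed.

End Polynomials.
End Bounds.

Local Notation pbound h p := (obound (pact h p)).
Local Notation ppos h p := (opos (pact h p)).

(** * Approximate square roots and positivity of squares *)

Section Positivity.
Context (R : realType) (A : cstarAlgType R).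
Implicit Types (a b c h : A) (p q : {poly R}) (f g : A -> A) (M N e t d : R).

Lemma exprn_small (x e : R) : 0 <= x -> x < 1 -> 0 < e -> exists n, x ^+ n <= e.
Proof.
move=> x0 x1 e0.
have /cvgrPdist_lt/(_ e e0) : ((fun n => x ^+ n) @ \oo --> (0 : R))%classic.
  by apply: cvg_expr; rewrite ger0_norm.
case=> n _ /(_ n (leqnn n)) /=; rewrite sub0r normrN ger0_norm ?exprn_ge0 // => /ltW.
by exists n.
Qed.

(* The square root of [1 - y] is [1 - z] with [z = (y + z^2) / 2]; the iteration
   of this equation from [0] is a contraction when [y] has norm less than [1]. *)
Lemma pbound_sqrt1B h y (rho d : R) : 0 <= rho -> rho < 1 -> 0 < d ->
  pbound h y rho ->
  exists2 g, pbound h (1 - g) 1 & pbound h (g ^+ 2 - (1 - y)) d.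
Proof.
move=> r0 r1 d0 yr.
pose z n : {poly R} := iter n (fun z => 2^-1 *: (y + z ^+ 2)) 0.
have zS n : z n.+1 = 2^-1 *: (y + z n ^+ 2) by [].
have zr n : pbound h (z n) rho.
  elim: n => [|n IH]; first by apply: obound_le (pbound0 h).
  apply: obound_le (pboundZ (2^-1) (pboundD yr (pbound_exp 2 r0 IH))).
  rewrite ger0_norm ?invr_ge0 // ler_pdivrMl // expr2.
  by rewrite mulr_natl mulr2n lerD2l ler_piMl // ltW.
have zd n : pbound h (z n.+1 - z n) (rho ^+ n.+1).
  elim: n => [|n IH].
    rewrite subr0 /z /= expr0n addr0 expr1.
    apply: obound_le (pboundZ _ yr).
    by rewrite ger0_norm ?invr_ge0 // ler_pdivrMl // ler_peMl // ler1n.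
  (* Each difference is the previous one times half the sum of two iterates, a factor of norm at
     most [rho]. *)
  have -> : z n.+2 - z n.+1 = 2^-1 *: ((z n.+1 - z n) * (z n.+1 + z n)).
    rewrite (zS n.+1) [X in _ - X = _]zS -scalerBr -subr_sqr.
    by congr (_ *: _); ring.
  apply: obound_le (pboundZ _ (pboundM _ IH (pboundD (zr _) (zr _)))).
    rewrite ger0_norm ?invr_ge0 // (exprSr _ n.+1).
    have -> : 2^-1 * (rho ^+ n.+1 * (rho + rho)) = rho ^+ n.+1 * rho by field.
    exact: lexx.
  exact: exprn_ge0.
have [n nd] := exprn_small r0 r1 (divr_gt0 d0 (ltr0n _ 2)).
exists (1 - z n); first by rewrite subKr; apply: obound_le (zr _); rewrite ltW.
(* The error of the approximate root is twice the next step of the iteration. *)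
have -> : (1 - z n) ^+ 2 - (1 - y) = 2 *: (z n.+1 - z n).
  rewrite zS scalerBr scalerA divff // scale1r.
  by rewrite -[2 *: z n]/(2%:R *: z n) scaler_nat; ring.
apply: obound_le (pboundZ _ (zd n)).
rewrite ger0_norm // exprS.
have : rho * rho ^+ n <= rho ^+ n by rewrite ler_piMl ?exprn_ge0 // ltW.
move: nd; lra.
Qed.

(** With [T = t + d/2] slightly larger than the bound [t + d/4], the element [y = (t - p) / T] has
    norm less than 1 and [T (1 - y) = p + d/2]. So [sqrt T] times an approximate root of [1 - y]
    works, with error [d/2] from the root and [d/2] from the shift. The bound on [t - g] records
    that the root is itself positive. *)
Lemma ppos_sqrt h p d : 0 < d -> ppos h p ->
  exists (g : {poly R}) t, [/\ 0 < t, pbound h (t%:P - g) t & pbound h (g ^+ 2 - p) d].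
Proof.
move=> d0 pp; have d2 : 0 < d / 2 by rewrite divr_gt0.
have d4 : 0 < d / 4 by rewrite divr_gt0.
have [t t0 pt] := pp _ d4.
pose T := t + d / 2; have T0 : 0 < T by rewrite addr_gt0.
pose y := T^-1 *: (t%:P - p).
have yr : pbound h y ((t + d / 4) / T).
  rewrite mulrC -[X in X * _]gtr0_norm ?invr_gt0 //; apply: pboundZ.
  by apply: eq_obound pt => b; rewrite pactB pactC.
have [|| g0 g01 g0d] := pbound_sqrt1B _ _ (divr_gt0 d2 T0) yr.
- by rewrite divr_ge0 ?ltW // addr_gt0.
- by rewrite ltr_pdivrMr // mul1r /T; lra.
pose s := Num.sqrt T; have s0 : 0 < s by rewrite sqrtr_gt0.
exists (s *: g0), s; split=> //.
- have -> : s%:P - s *: g0 = s *: (1 - g0) by rewrite scalerBr alg_polyC.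
  by apply: obound_le (pboundZ _ g01); rewrite gtr0_norm // mulr1.
have -> : (s *: g0) ^+ 2 - p = T *: (g0 ^+ 2 - (1 - y)) + (d / 2)%:P.
  rewrite exprZn sqr_sqrtr ?ltW // !scalerBr scalerA divff ?gt_eqF // scale1r.
  by rewrite alg_polyC /T polyCD; ring.
apply: obound_le (pboundD (pboundZ _ g0d) (pboundC _ _)).
rewrite !gtr0_norm // mulrC divfK ?gt_eqF //; lra.
Qed.

(** For [x = p(h)], [(t - x^2)^2 + 2 t x^2 = t^2 + x^4]. Choosing [t] with [K^4 = 2 t e] bounds the
    right side by [(t + e)^2], and [pbound_sumsq] applies. *)
Lemma ppos_sqr h p : star h = h -> ppos h (p ^+ 2).
Proof.
move=> hh e e0; have [K K0 pK] := pbound_exists h p.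
have [t t0 tE] : exists2 t, 0 < t & K ^+ 4 = 2 * t * e.
  exists (K ^+ 4 / (2 * e)); first by rewrite divr_gt0 ?exprn_gt0 ?mulr_gt0.
  by field; rewrite gt_eqF.
exists t => //.
suff : pbound h (t%:P - p ^+ 2) (t + e).
  by apply: eq_obound => b; rewrite pactB pactC.
apply: (@pbound_sumsq _ _ _ hh _ (Num.sqrt (2 * t) *: p)); first by rewrite addr_ge0 ?ltW.
have -> : (t%:P - p ^+ 2) ^+ 2 + (Num.sqrt (2 * t) *: p) ^+ 2 = (t ^+ 2)%:P + p ^+ 4.
  rewrite -mul_polyC exprMn -polyC_exp sqr_sqrtr ?mulr_ge0 ?ltW // !polyCM polyC_natr; ring.
apply: obound_le (pboundD (pboundC _ _) (pbound_exp 4 (ltW K0) pK)).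
rewrite ger0_norm ?sqr_ge0 //.
have := sqr_ge0 e; rewrite tE; nra.
Qed.

(* With [g^2] close to [p] and [l^2] to [mu - p], the commuting self-adjoint
   elements [p - mu / 2] and [g l] have sum of squares close to [(mu / 2)^2]. *)
Lemma pbound_of_ppos h p (mu : R) : star h = h -> 0 <= mu ->
  ppos h p -> ppos h (mu%:P - p) -> pbound h p mu.
Proof.
move=> hh mu0 pp qp; set q := mu%:P - p in qp.
have [K K0 pK] := pbound_exists h p; have [L L0 qL] := pbound_exists h q.
suff ek : pbound h (p - (mu / 2)%:P) (mu / 2).
  rewrite -(subrK (mu / 2)%:P p).
  by apply: obound_le (pboundD ek (pboundC _ _)); rewrite ger0_norm ?divr_ge0 //; lra.
apply: obound_lim => e e0.
have m0 : 0 <= mu / 2 + e by rewrite addr_ge0 ?divr_ge0 // ltW.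
(* The error terms below have norm at most [d^2 + d L + K d], which is at most
   [d (K + L + 1) <= e^2] because [d <= 1]. *)
pose d := Num.min 1 (e ^+ 2 / (K + L + 1)).
have KL : 0 < K + L + 1 by rewrite !addr_gt0.
have d0 : 0 < d by rewrite lt_min ltr01 divr_gt0 ?exprn_gt0.
have [g [_ [_ _ gd]]] := ppos_sqrt d0 pp.
have [l [_ [_ _ ld]]] := ppos_sqrt d0 qp.
apply: (@pbound_sumsq _ _ _ hh _ (g * l)) => //.
have -> : (p - (mu / 2)%:P) ^+ 2 + (g * l) ^+ 2 =
    ((mu / 2) ^+ 2)%:P + ((g ^+ 2 - p) * (l ^+ 2 - q) + (g ^+ 2 - p) * q + p * (l ^+ 2 - q)).
  rewrite /q polyC_exp.
  have -> : mu%:P = (mu / 2)%:P + (mu / 2)%:P by rewrite -polyCD -splitr.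
  ring.
apply: obound_le (pboundD (pboundC _ _) (pboundD
  (pboundD (pboundM (ltW d0) gd ld) (pboundM (ltW d0) gd qL)) (pboundM (ltW K0) pK ld))).
rewrite ger0_norm ?sqr_ge0 //.
have d1 : d <= 1 by rewrite ge_min lexx.
have : d * (K + L + 1) <= e ^+ 2 by rewrite -ler_pdivlMr // ge_min lexx orbT.
have : d * d <= d by rewrite ler_piMl // ltW.
have : 0 <= mu * e by rewrite mulr_ge0 // ltW.
nra.
Qed.

End Positivity.

(** * Positivity of [star a . a] *)

Section Squares.
Context (R : realType) (A : cstarAlgType R).
Implicit Types (a b c h : A) (p q : {poly R}) (f g : A -> A) (M N e t : R).

(** Squaring Bernoulli's inequality gives growth quadratic in the exponent: with [r = 1 + s] and
    [m = 2^i], [r^(2m) >= (1 + m s)^2 >= 1 + m^2 s^2], and [m s^2 >= 2 C] suffices. *)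
Lemma exprn_pow2_ge (r C : R) : 1 < r -> 0 <= C ->
  exists j, 1 + (2 ^ j)%:R * C <= r ^+ (2 ^ j).
Proof.
move=> r1 C0; have [s s0 ->] : exists2 s, 0 < s & r = 1 + s.
  by exists (r - 1); [rewrite subr_gt0|rewrite addrC subrK].
have bern m : 1 + m%:R * s <= (1 + s) ^+ m.
  elim: m => [|m IH]; first by rewrite mul0r addr0 expr0.
  rewrite exprS -natr1; have : 1 <= (1 + s) ^+ m by rewrite exprn_ege1 // lerDl ltW.
  by move: IH; nra.
pose i := Num.bound (2 * C / s ^+ 2); exists i.+1.
have iP : 2 * C <= (2 ^ i)%:R * s ^+ 2.
  rewrite -ler_pdivrMr ?exprn_gt0 // (le_trans (ltW (archi_boundP _))) //.
    by rewrite divr_ge0 ?mulr_ge0 ?exprn_ge0 // ltW.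
  by rewrite ler_nat ltnW // ltn_expl.
have b := bern (2 ^ i)%N.
rewrite expnS mulnC exprM natrM.
have m0 : 0 <= (2 ^ i)%:R :> R by [].
have : (1 + (2 ^ i)%:R * s) ^+ 2 <= ((1 + s) ^+ (2 ^ i)) ^+ 2.
  rewrite ler_pXn2r // nnegrE ?exprn_ge0 ?addr_ge0 ?mulr_ge0 //; lra.
apply: le_trans; move: m0 iP; move: (2 ^ i)%:R => m m0 iP; nra.
Qed.

Lemma opos_subr f M : 0 <= M -> obound f M -> opos (fun b => M%:C *: b - f b).
Proof.
(* [M] may be zero, while the definition of [opos] asks for [t > 0]. *)
move=> M0 fM e e0; exists (M + 1); first by rewrite ltr_wpDl.
apply: (@obound_le _ _ _ (1 + M)); first lra.
have o1 : obound (fun b : A => b) 1 by move=> b; rewrite mul1r.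
apply: eq_obound (oboundD o1 fM) => b.
by rewrite rmorphD rmorph1 scalerDl scale1r opprB [RHS]addrC [RHS]addrA subrK addrC.
Qed.

(* Write [k] for [star c]: [(t + c k)^n = t^n + c Q(k c) k] for a polynomial [Q]
   with [Q(k c)] of norm [O(n M^(n-1))]; the powers [n = 2^j] remove the
   factor [n] in the limit. *)
Lemma obound_star_swap c t M N : 0 < t -> t <= M -> M < N ->
  obound (fun b => t%:C *: b + cmul (cmul (star c) c) b) M ->
  obound (fun b => t%:C *: b + cmul (cmul c (star c)) b) N.
Proof.
set h := cmul (star c) c; set h' := cmul c (star c) => t0 tM MN hM.
have M0 : 0 < M by exact: lt_le_trans tM.
have N0 : 0 < N by exact: lt_trans MN.
have hh' : star h' = h' by rewrite starM starK.
pose p : {poly R} := t%:P + 'X.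
have pM : pbound h p M by apply: eq_obound hM => b; rewrite pactD pactC pactX.
suff : pbound h' p N by apply: eq_obound => b; rewrite pactD pactC pactX.
have pn n : pbound h' (p ^+ n) (t ^+ n + n%:R * M ^+ n.-1 * rnorm c ^+ 2).
  pose Q := \sum_(i < n) p ^+ (n.-1 - i) * t%:P ^+ i.
  have -> : p ^+ n = (t ^+ n)%:P + Q * 'X.
    by rewrite mulrC polyC_exp /Q -[X in X * _](addKr t%:P 'X) [- _ + _]addrC -subrXX addrC subrK.
  have Qn : pbound h Q (n%:R * M ^+ n.-1).
    apply: (@obound_le _ _ _ (\sum_(i < n) M ^+ (n.-1 - i) * M ^+ i)).
      rewrite -[n in n%:R]card_ord -sumr_const mulr_suml; apply: ler_sum => i _.
      by rewrite -exprD subnK ?mul1r // -ltnS prednK // (leq_ltn_trans _ (ltn_ord i)).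
    apply: pbound_sum => i; apply: pboundM; rewrite ?exprn_ge0 ?ltW //.
      by apply: pbound_exp => //; rewrite ltW.
    apply: pbound_exp; first by rewrite ltW.
    by apply: obound_le (pboundC _ _); rewrite gtr0_norm.
  have Qc : pbound h' (Q * 'X) (n%:R * M ^+ n.-1 * rnorm c ^+ 2).
    move=> b; rewrite pactMX -cmulA (@pact_intertwine _ _ h); last first.
      by move=> b'; rewrite !cmulA.
    have k0 : 0 <= n%:R * M ^+ n.-1 by rewrite mulr_ge0 ?exprn_ge0 // ltW.
    move: k0 Qn; set k := n%:R * _ => k0 Qn.
    apply: le_trans (rnorm_cmul _ _) _.
    have -> : k * rnorm c ^+ 2 * rnorm b = rnorm c * (k * (rnorm (star c) * rnorm b)).
      by rewrite rnorm_star; ring.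
    rewrite ler_wpM2l ?rnorm_ge0 // (le_trans (Qn _)) // ler_wpM2l //.
    exact: rnorm_cmul.
  apply: obound_le (pboundD (pboundC _ _) Qc).
  by rewrite ger0_norm ?exprn_ge0 // ltW.
have r1 : 1 < N / M by rewrite ltr_pdivlMr // mul1r.
(* For [n = 2^j] this says [M^n + n M^(n-1) |c|^2 <= N^n], which dominates the bound [pn] since
   [t <= M]. *)
have [|j jP] := @exprn_pow2_ge _ (rnorm c ^+ 2 / M) r1.
  by rewrite divr_ge0 ?exprn_ge0 ?rnorm_ge0 // ltW.
have : pbound h' (p ^+ (2 ^ j)) (N ^+ (2 ^ j)).
  apply: obound_le (pn _).
  have n0 : (0 < 2 ^ j)%N by rewrite expn_gt0.
  rewrite expr_div_n ler_pdivlMr ?exprn_gt0 // in jP; apply: le_trans jP.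
  rewrite mulrDl mul1r; apply: lerD; first by rewrite ler_pXn2r // nnegrE ltW.
  have -> : M ^+ (2 ^ j) = M ^+ (2 ^ j).-1 * M by rewrite -exprSr prednK.
  rewrite le_eqVlt; apply/orP; left; apply/eqP; field; by rewrite gt_eqF.
(* The bound on the power [2^j] descends to [p] by taking [j] square roots. *)
elim: j {jP} => [|j IH]; first by rewrite expn0 !expr1.
rewrite expnS mulnC !exprM => /pbound_sqr; move/(_ hh'); rewrite exprn_ge0 ?ltW //.
by move/(_ isT).
Qed.

(** Positivity of [d - star c . c] amounts to norm bounds on [t + star c . c], which
    [obound_star_swap] transfers to [t + c . star c]. *)
Lemma opos_star_swap c (d : R) : 0 <= d ->
  opos (fun b => d%:C *: b - cmul (cmul (star c) c) b) ->
  opos (fun b => d%:C *: b - cmul (cmul c (star c)) b).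
Proof.
move=> d0 cp e e0; have e2 : 0 < e / 2 by rewrite divr_gt0.
have [t t0 ct] := cp _ e2.
exists (t + d); first by rewrite ltr_wpDr.
have ctd : obound (fun b => t%:C *: b + cmul (cmul (star c) c) b) (t + e / 2 + d).
  apply: eq_obound (oboundD ct (_ : obound (fun b => d%:C *: b) d)) => b.
    by rewrite opprB addrA subrK.
  by rewrite rnormZ ger0_norm.
have cN : obound (fun b => t%:C *: b + cmul (cmul c (star c)) b) (t + d + e).
  by apply: obound_star_swap ctd => //; lra.
by apply: eq_obound cN => b; rewrite rmorphD /= scalerDl opprB addrACA subrr addr0.
Qed.

Lemma opos_sqr c : star c = c -> opos (fun b => cmul c (cmul c b)).
Proof.
move=> cc; apply: eq_opos (ppos_sqr 'X cc) => b.
by rewrite expr2 pactM !pactX.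
Qed.

(** The sum equals [(x^2 + y^2) / 2] for the self-adjoint [x = c + star c] and
    [y = i (c - star c)]. *)
Lemma opos_star_add c :
  opos (fun b => cmul (cmul (star c) c) b + cmul (cmul c (star c)) b).
Proof.
pose x := c + star c; pose y := 'i *: (c - star c).
have xx : star x = x by rewrite starD starK addrC.
have yy : star y = y.
  rewrite starZ starD starN starK.
  have -> : 'i^* = - 'i :> R[i] by apply/eqP; rewrite eq_complex /= !oppr0 !eqxx.
  by rewrite scaleNr -scalerN opprB.
have := oposZ (_ : 0 < 2^-1) (oposD (opos_sqr xx) (opos_sqr yy)).
rewrite invr_gt0 ltr0n => /(_ isT); apply: eq_opos => b.
rewrite /x /y !(cmulZl, cmulZr) scalerA -expr2 sqr_i scaleN1r.
rewrite !cmulDl !cmulNl !cmulDr !cmulNr -!cmulA.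
move: (cmul c (cmul c b)) (cmul c (cmul (star c) b)) (cmul (star c) (cmul c b))
  (cmul (star c) (cmul (star c) b)) => u v w z.
have -> : u + v + (w + z) - (u - v - (w - z)) = 2%:R%:C *: (w + v).
  rewrite rmorph_nat scaler_nat mulr2n !opprB [w - z + _]addrC addrACA.
  by rewrite [u + v]addrC (addrACA v) subrr addr0 (addrACA w) subrr addr0 addrC addrACA.
by rewrite scalerA -rmorphM /= mulVf // scale1r.
Qed.

(** The argument avoids positivity of [star c . c], which is still to be proved. Let
    [s = star c . c + q^2]. Then [d - star c . c = (d - s) + q^2] is positive, hence so is
    [d - c . star c], and [2d - q^2] is the sum of [d - s], [d - c . star c] and
    [star c . c + c . star c]. *)
Lemma pbound_sqr_of_star h c q (d : R) : star h = h -> 0 <= d ->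
  obound (fun b => cmul (cmul (star c) c) b + pact h (q ^+ 2) b) d ->
  pbound h (q ^+ 2) (2 * d).
Proof.
move=> hh d0 sd; apply: pbound_of_ppos => //; [by rewrite mulr_ge0|exact: ppos_sqr|].
have sp := opos_subr d0 sd.
have : opos (fun b => d%:C *: b - cmul (cmul (star c) c) b).
  by apply: eq_opos (oposD sp (ppos_sqr q hh)) => b; rewrite opprD addrA subrK.
move=> /(opos_star_swap d0) cp.
apply: eq_opos (oposD (oposD sp cp) (opos_star_add c)) => b.
rewrite pactB pactC mulr_natl mulr2n rmorphD scalerDl.
move: (cmul _ b) (cmul _ b) (pact _ _ b) (_ *: b) => u v w z.
by rewrite addrACA subrK opprD [- v - w]addrC addrA subrK addrAC.
Qed.

Lemma cmul_pact h p b c : cmul (pact h p b) c = pact h p (cmul b c).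
Proof.
elim/poly_ind: p b => [|p r IH] b.
  by rewrite -[0]polyC0 !pactC !rmorph0 !scale0r cmul0l.
by rewrite !pactD !pactMX !pactC cmulDl IH cmulZl -cmulA.
Qed.

Lemma opos_starM a : opos (cmul (cmul (star a) a)).
Proof.
set h := cmul (star a) a.
have hh : star h = h by rewrite starM starK.
suff: ppos h 'X by apply: eq_opos => b; rewrite pactX.
apply: opos_lim => e e0.
pose K := rnorm h; have K0 : 0 <= K := rnorm_ge0 _.
pose L := 2 * K + 1; have L0 : 0 < L by rewrite /L; lra.
(* The final bound on [v^4] is [d B]: the factor [5 L + 6 L^2] comes from [v^3], the outer [L] from
   one more [v]. *)
pose B := L * (5 * L + 6 * L ^+ 2).
have B0 : 0 < B by rewrite mulr_gt0 // addr_gt0 ?mulr_gt0 ?exprn_gt0.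
pose d := Num.min 1 (e ^+ 4 / B).
have d0 : 0 < d by rewrite lt_min ltr01 divr_gt0 ?exprn_gt0.
have d1 : d <= 1 by rewrite ge_min lexx.
have dB : d * B <= e ^+ 4 by rewrite -ler_pdivlMr // ge_min lexx orbT.
have [P [t [t0 Pt Pd]]] := ppos_sqrt d0 (ppos_sqr 'X hh).
have Ppos : ppos h P.
  move=> e' e'0; exists t => //; apply: (@obound_le _ _ _ t); first by rewrite lerDl ltW.
  by apply: eq_obound Pt => b; rewrite pactB pactC.
have [Q [_ [_ _ Qd]]] := ppos_sqrt d0 Ppos.
exists (pact h P) => //.
pose v := P - 'X.
suff : pbound h v e.
  by move=> /oboundN; apply: eq_obound => b; rewrite pactB opprB.
have PK : pbound h P (K + 1).
  apply: pbound_sqr => //; first by rewrite addr_ge0.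
  rewrite -(subrK ('X ^+ 2) (P ^+ 2)).
  apply: obound_le (pboundD Pd (pbound_exp 2 K0 (@pboundX _ _ h))).
  by move: K0 d1; nra.
have vL : pbound h v L.
  by apply: obound_le (pboundB PK (@pboundX _ _ h)); rewrite /L -/K; lra.
pose s := L * d + L ^+ 2 * d.
have v2L : pbound h (v ^+ 2) (L ^+ 2) by apply: pbound_exp => //; rewrite ltW.
have S : pbound h (v ^+ 2 * ('X + Q ^+ 2)) s.
  have -> : v ^+ 2 * ('X + Q ^+ 2) = v * (P ^+ 2 - 'X ^+ 2) + v ^+ 2 * (Q ^+ 2 - P).
    by rewrite /v; ring.
  apply: pboundD; apply: pboundM => //; first by rewrite ltW.
  by rewrite exprn_ge0 // ltW.
have q2 : pbound h ((Q * v) ^+ 2) (2 * s).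
  (* This is the element [a v(h)], written through its adjoint because [pact] acts on the left. *)
  apply: (@pbound_sqr_of_star _ (star (pact h v (star a)))) => //.
    by rewrite addr_ge0 // mulr_ge0 ?exprn_ge0 // ltW.
  apply: eq_obound S => b.
  have -> : v ^+ 2 * ('X + Q ^+ 2) = v * 'X * v + (Q * v) ^+ 2 by ring.
  rewrite pactD; congr (_ + _).
  rewrite starK -cmulA star_pact // starK cmul_pact pactM pactMX; congr (pact h v _).
  by rewrite cmulA.
have v3 : pbound h (v ^+ 3) (3 * s + (2 * s + L ^+ 2 * d)).
  (* This splits [v^3] as [- v^2 h + v^2 P]; each summand is [(Q v)^2] minus a term already known to
     be small. *)
  have -> : v ^+ 3 = ((Q * v) ^+ 2 - v ^+ 2 * ('X + Q ^+ 2))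
      + ((Q * v) ^+ 2 - v ^+ 2 * (Q ^+ 2 - P)) by rewrite /v; ring.
  apply: pboundD.
    by apply: obound_le (pboundB q2 S); lra.
  by apply: pboundB => //; apply: pboundM => //; rewrite exprn_ge0 // ltW.
have s0 : 0 <= 3 * s + (2 * s + L ^+ 2 * d).
  by rewrite /s !(addr_ge0, mulr_ge0, exprn_ge0) // ltW.
have v4 : pbound h ((v ^+ 2) ^+ 2) ((e ^+ 2) ^+ 2).
  have -> : (v ^+ 2) ^+ 2 = v ^+ 3 * v by ring.
  apply: obound_le (pboundM s0 v3 vL).
  have -> : (e ^+ 2) ^+ 2 = e ^+ 4 by ring.
  by apply: le_trans dB; rewrite /B /s le_eqVlt; apply/orP; left; apply/eqP; ring.
do 2![apply: pbound_sqr => //; rewrite ?exprn_ge0 ?ltW //].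
Qed.

End Squares.

(** * Monotonicity of the norm and the bound for the diagonal operator *)

Section NormMonotone.
Context (R : realType) (A : cstarAlgType R).
Implicit Types (a b c u : A) (t : R).

(** Since [|s| - p = (|s| - s) + (s - p)] is positive, left multiplication by [p] is bounded by
    [|s|]. Applying it to [p] itself gives [|p|^2 <= |s| |p|]. *)
Lemma rnorm_le_of_opos (p s : A) : star p = p -> opos (cmul p) -> opos (cmul (s - p)) ->
  rnorm p <= rnorm s.
Proof.
move=> pp p0 sp.
have : pbound p 'X (rnorm s).
  apply: pbound_of_ppos => //; first exact: rnorm_ge0.
    by apply: eq_opos p0 => b; rewrite pactX.
  apply: eq_opos (oposD (opos_subr (rnorm_ge0 s) (obound_cmul s)) sp) => b.
  by rewrite pactB pactC pactX cmulDl cmulNl addrA subrK.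
move/(_ p); rewrite pactX -{1}pp rnorm_starM expr2.
have [->|p_neq0] := eqVneq (rnorm p) 0; first by rewrite rnorm_ge0.
by rewrite ler_pM2r // lt_def p_neq0 rnorm_ge0.
Qed.

(** As [|b| < t], some [g(h)] has square close to [1 - h / t^2]. The element is then close to [t^2]
    times [star w . w] with [w = g(h) u]. *)
Lemma opos_compress b u t : rnorm b < t ->
  opos (cmul (cmul (star u) ((t ^+ 2)%:C *: u - cmul (cmul (star b) b) u))).
Proof.
move=> bt; have t0 : 0 < t := le_lt_trans (rnorm_ge0 _) bt.
set h := cmul (star b) b; have hh : star h = h by rewrite starM starK.
apply: opos_lim => d d0.
have t20 : 0 < t ^+ 2 by rewrite exprn_gt0.
pose C := t ^+ 2 * rnorm u ^+ 2 + 1.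
have C0 : 0 < C by rewrite ltr_wpDl // mulr_ge0 ?exprn_ge0 ?rnorm_ge0 // ltW.
have yb := pboundZ (t ^- 2) (@pboundX _ _ h).
have [||g _ gd] := pbound_sqrt1B _ _ (divr_gt0 d0 C0) yb.
- by rewrite mulr_ge0 ?rnorm_ge0.
- rewrite gtr0_norm ?invr_gt0 // mulrC ltr_pdivrMr // mul1r rnorm_starM.
  by rewrite ltr_pXn2r // nnegrE ?rnorm_ge0 // ltW.
pose w := pact h g u.
exists (fun c => (t ^+ 2)%:C *: cmul (cmul (star w) w) c); first exact/oposZ/opos_starM.
have E : cmul (star u) ((t ^+ 2)%:C *: u - cmul h u) - (t ^+ 2)%:C *: cmul (star w) w =
    - ((t ^+ 2)%:C *: cmul (star u) (pact h (g ^+ 2 - (1 - t ^- 2 *: 'X)) u)).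
  rewrite /w star_pact // -pactM -expr2 !pactB pact1 pactZ pactX.
  rewrite -[X in _ = - X]cmulZr -[RHS]cmulNr -[X in _ - X = _]cmulZr.
  rewrite -[X in _ + X = _]cmulNr -cmulDr; congr (cmul _ _).
  rewrite !scalerBr scalerA -rmorphM /= divff ?gt_eqF // rmorph1 scale1r.
  by rewrite opprB addrC.
have Ed : rnorm (cmul (star u) ((t ^+ 2)%:C *: u - cmul h u)
    - (t ^+ 2)%:C *: cmul (star w) w) <= d.
  rewrite E rnormN rnormZ gtr0_norm //.
  have := le_trans (rnorm_cmul (star u) _) (ler_wpM2l (rnorm_ge0 _) (gd u)).
  rewrite rnorm_star => /(ler_wpM2l (ltW t20)) /le_trans; apply.
  have -> : t ^+ 2 * (rnorm u * (d / C * rnorm u)) = d * (t ^+ 2 * rnorm u ^+ 2 / C).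
    by move: (C^-1) => iC; ring.
  by rewrite ler_piMr ?(ltW d0) // ler_pdivrMr // mul1r lerDl.
apply: (obound_le Ed) => c.
by apply: le_trans (rnorm_cmul _ _); rewrite cmulDl cmulNl cmulZl.
Qed.

Context (V : hilbertModType A).
Implicit Types (x y z : V) (w : A * V).

Lemma inner0r x : inner x 0 = 0 :> A.
Proof. by apply: (addrI (inner x 0)); rewrite -innerDr !addr0. Qed.

Lemma innerDl x y z : inner (x + y) z = inner x z + inner y z :> A.
Proof. by rewrite -star_inner innerDr starD !star_inner. Qed.

Lemma innerZl k x y : inner (k *: x) y = conjc k *: inner x y :> A.
Proof. by rewrite -star_inner innerZr starZ star_inner. Qed.

Lemma innerMl x y a : inner (act x a) y = cmul (star a) (inner x y).
Proof. by rewrite -star_inner innerMr starM star_inner. Qed.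

Lemma inner_injl x y : (forall z, inner x z = inner y z :> A) -> x = y.
Proof.
move=> xy; apply/eqP; rewrite -subr_eq0; apply/eqP; apply/inner_eq0.
by move: {2}(x - y) => z; rewrite innerDl xy -scaleN1r innerZl rmorphN1 scaleN1r subrr.
Qed.

Lemma opos_inner x : opos (cmul (inner x x : A)).
Proof. by have [c ->] := inner_ge0 x; exact: opos_starM. Qed.

Lemma dsinner_star w : star (dsinner w w) = dsinner w w.
Proof. by rewrite /dsinner starD starM starK star_inner. Qed.

Lemma dsnorm_ge0 w : 0 <= dsnorm w.
Proof. exact: sqrtr_ge0. Qed.

Lemma rnorm_fst_le w : rnorm w.1 <= dsnorm w.
Proof.
rewrite -(@ler_pXn2r _ 2) ?nnegrE ?rnorm_ge0 ?dsnorm_ge0 //.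
rewrite sqr_sqrtr ?rnorm_ge0 // -rnorm_starM.
apply: rnorm_le_of_opos; first by rewrite starM starK.
  exact: opos_starM.
by rewrite /dsinner addrC addKr; exact: opos_inner.
Qed.

Definition diagop b t w : A * V := (cmul b w.1, t%:C *: w.2).

(** In [t^2 <w, w> - <B w, B w>] the contributions of [V] cancel, leaving the positive element of
    [opos_compress] with [u = w.1]. *)
Lemma dsnorm_diagop b t w : rnorm b < t -> dsnorm (diagop b t w) <= t * dsnorm w.
Proof.
move=> bt; have t0 : 0 < t := le_lt_trans (rnorm_ge0 _) bt.
rewrite -(@ler_pXn2r _ 2) ?nnegrE ?mulr_ge0 ?dsnorm_ge0 ?(ltW t0) //.
rewrite exprMn !sqr_sqrtr ?rnorm_ge0 //.
have -> : t ^+ 2 * rnorm (dsinner w w) = rnorm ((t ^+ 2)%:C *: dsinner w w).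
  by rewrite rnormZ gtr0_norm // exprn_gt0.
apply: rnorm_le_of_opos; first exact: dsinner_star.
  apply: eq_opos (oposD (opos_starM (cmul b w.1)) (opos_inner (t%:C *: w.2))) => c.
  by rewrite -cmulDl.
suff -> : (t ^+ 2)%:C *: dsinner w w - dsinner (diagop b t w) (diagop b t w) =
  cmul (star w.1) ((t ^+ 2)%:C *: w.1 - cmul (cmul (star b) b) w.1) by exact: opos_compress.
rewrite /dsinner /diagop /= innerZl innerZr conjc_real scalerA -rmorphM /= -expr2.
rewrite scalerDr starM cmulDr cmulZr cmulNr -!cmulA opprD addrACA.
by rewrite subrr addr0.
Qed.

End NormMonotone.

(** * States of the linking algebra *)

Section Linking.
Context (R : realType) (A : cstarAlgType R) (V : hilbertModType A).
Implicit Types (a b : A) (x y : V) (w : A * V) (t : R) (T : V -> V).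
Implicit Types (S : A * V -> A * V) (phi : (A * V -> A * V) -> R[i]).
Local Notation linking := (@linking_algebra R A V).

Lemma opnorm_le1P S : (opnorm (@dsnorm R A V) (@dsnorm R A V) S <= 1)%E <->
  forall w, dsnorm w <= 1 -> dsnorm (S w) <= 1.
Proof.
split=> [S1 w w1|S1].
  by rewrite -lee_fin; apply: le_trans S1; apply: ereal_sup_ubound; exists w.
by apply: ge_ereal_sup => _ [w w1 <-]; rewrite lee_fin S1.
Qed.

Lemma adjointable_scale T k x : adjointable T -> T (k *: x) = k *: T x.
Proof.
by case=> T' TT'; apply: inner_injl => z; rewrite TT' !innerZl TT'.
Qed.

Lemma compact_ops_scale T t : 0 < t -> compact_ops T -> compact_ops (fun x => t%:C *: T x).
Proof.
move=> t0 [[T' TT'] Tc]; split.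
  by exists (fun y => t%:C *: T' y) => x y; rewrite innerZl innerZr TT' conjc_real.
move=> e e0; have [F [n [k [xs [ys FE]]]] TF] := Tc _ (divr_gt0 e0 t0).
exists (fun z => t%:C *: F z).
  exists n, (fun i => t%:C * k i), xs, ys; apply/funext => z.
  by rewrite FE scaler_sumr; apply: eq_bigr => i _; rewrite scalerA.
(* The operator norm is a real number [s]: it lies below [e / t], and the value at zero excludes
   minus infinity. *)
have [s TFs se] : exists2 s : R,
    (opnorm (@rnorm R V) (@rnorm R V) (fun z => (T z - F z)%R) <= s%:E)%E & s < e / t.
  move: TF; set o := opnorm _ _ _.
  have o0 : (0%:E <= o)%E.
    apply: ereal_sup_ubound; exists 0; first by rewrite /= rnorm0.
    have FT0 : T 0 - F 0 = 0.
      rewrite -[X in T X](scale0r (0 : V)) adjointable_scale ?scale0r; last by exists T'.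
      rewrite FE big1 ?subrr // => i _; rewrite /theta inner0r.
      by rewrite -(scale0r (0 : A)) actZr scale0r scaler0.
    by rewrite FT0 rnorm0.
  by case: o o0 => // s _ se; exists s => //; rewrite -lte_fin.
apply: (@le_lt_trans _ _ (t * s)%:E); last first.
  by rewrite lte_fin mulrC -ltr_pdivlMr.
apply: ge_ereal_sup => _ [z z1 <-]; rewrite lee_fin -scalerBr rnormZ gtr0_norm // ler_pM2l //.
by rewrite -lee_fin; apply: le_trans TFs; apply: ereal_sup_ubound; exists z.
Qed.

Lemma compact_ops0 : compact_ops ((fun=> 0) : V -> V).
Proof.
split; first by exists (fun=> 0) => x y; rewrite inner0r -star_inner inner0r star0.
move=> e e0; exists (fun=> 0).
  by exists 0%N, (fun=> 0), (fun=> 0), (fun=> 0); apply/funext => z; rewrite big_ord0.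
apply: (@le_lt_trans _ _ 0%:E); last by rewrite lte_fin.
by apply: ge_ereal_sup => _ [z z1 <-]; rewrite subr0 rnorm0.
Qed.

Definition lower x : A * V -> A * V := block_op (fun=> 0) (fun=> 0) (r_ x) (fun=> 0).

Lemma lower_linking x : linking (lower x).
Proof.
exists 0, x, 0, (fun=> 0); split; first exact: compact_ops0.
apply/funext => w; rewrite /lower /block_op /T_ /l_ cmul0l.
by rewrite -(star_inner w.2) inner0r star0.
Qed.

(** The operator [diagop b t] need not lie in the linking algebra, as the identity of [V] may fail
    to be compact. Composing with it keeps the block form, with the compact corner multiplied by
    [t]. *)
Lemma linking_comp_diagop b t S : 0 < t -> linking S -> linking (S \o @diagop R A V b t).
Proof.
move=> t0 [a [x [y [T [Tc ->]]]]].
exists (cmul a b), (act x b), (t%:C *: y), (fun z => t%:C *: T z); split.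
  exact: compact_ops_scale.
apply/funext => w; rewrite /block_op /diagop /= /T_ /r_ /l_.
rewrite (adjointable_scale _ _ (proj1 Tc)) innerZl innerZr conjc_real cmulA.
by rewrite actA.
Qed.

Lemma diagop_comp_linking b t S : 0 < t -> linking S ->
  linking (@diagop R A V (star b) t \o S).
Proof.
move=> t0 [a [x [y [T [Tc ->]]]]].
exists (cmul (star b) a), (t%:C *: x), (act y b), (fun z => t%:C *: T z); split.
  exact: compact_ops_scale.
apply/funext => w; rewrite /block_op /diagop /= /T_ /r_ /l_.
by rewrite cmulDr cmulA innerMl scalerDr actZl.
Qed.

Lemma dsinner_diagop b t (v w : A * V) :
  dsinner (diagop b t v) w = dsinner v (diagop (star b) t w).
Proof.
by rewrite /dsinner /diagop /= starM -cmulA innerZl innerZr conjc_real.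
Qed.

Definition compress b t S : A * V -> A * V :=
  @diagop R A V (star b) t \o (S \o @diagop R A V b t).

Lemma compress_linking b t S : 0 < t -> linking S -> linking (compress b t S).
Proof. by move=> t0 Sl; apply/diagop_comp_linking/linking_comp_diagop. Qed.

Lemma compress_lower b t x : compress b t (lower x) = fun w => t%:C *: lower (act x b) w.
Proof.
apply/funext => w; rewrite /compress /lower /block_op /diagop /= /r_ !addr0.
by rewrite cmul0 -actA; congr (_, _); rewrite scaler0.
Qed.

Lemma linking0 : linking (fun=> 0).
Proof.
have := lower_linking 0; congr linking; apply/funext => w.
rewrite /lower /block_op /r_ !addr0; congr (_, _).
by rewrite -(scale0r (0 : V)) actZl !scale0r.
Qed.

Lemma linking_linear0 phi : linking_linear phi -> phi (fun=> 0) = 0.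
Proof.
move=> phil; have := phil 1 _ _ linking0 linking0.
rewrite scale1r addr0 mul1r => /(congr1 (fun z => z - phi (fun=> 0))).
by rewrite subrr addrK.
Qed.

Lemma linking_linearZ phi k S : linking_linear phi -> linking S ->
  phi (fun w => k *: S w) = k * phi S.
Proof.
move=> phil Sl; rewrite -[RHS]addr0 -(linking_linear0 phil) -(phil _ _ _ Sl linking0).
by congr phi; apply/funext => w; rewrite addr0.
Qed.

Lemma linking_fnorm_leP phi (M : R) : (linking_fnorm phi <= M%:E)%E <->
  forall S, linking S -> (forall w, dsnorm w <= 1 -> dsnorm (S w) <= 1) -> rnorm (phi S) <= M.
Proof.
split=> [phiM S Sl /opnorm_le1P S1|phiM].
  by rewrite -lee_fin; apply: le_trans phiM; apply: ereal_sup_ubound; exists S.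
by apply: ge_ereal_sup => _ [S [Sl /opnorm_le1P S1] <-]; rewrite lee_fin phiM.
Qed.

Lemma rnorm_inner x : rnorm (inner x x : A) = rnorm x ^+ 2.
Proof. by apply: complexI; rewrite rmorphXn /= -!rnormE normV. Qed.

Lemma rnorm_act x a : rnorm (act x a) <= rnorm x * rnorm a.
Proof.
rewrite -(@ler_pXn2r _ 2) ?nnegrE ?mulr_ge0 ?rnorm_ge0 //.
rewrite -rnorm_inner innerMl innerMr (le_trans (rnorm_cmul _ _)) // rnorm_star.
have := rnorm_cmul (inner x x) a; rewrite rnorm_inner => /(ler_wpM2l (rnorm_ge0 a)) /le_trans.
by apply; rewrite le_eqVlt; apply/orP; left; apply/eqP; ring.
Qed.

Lemma dsnorm_lower x w : dsnorm (lower x w) <= rnorm x * dsnorm w.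
Proof.
have -> : dsnorm (lower x w) = rnorm (act x w.1).
  rewrite /dsnorm /dsinner /lower /block_op /= !addr0 star0 cmul0 add0r /r_ rnorm_inner.
  by rewrite sqrtr_sqr ger0_norm ?rnorm_ge0.
by apply: le_trans (rnorm_act _ _) _; rewrite ler_wpM2l ?rnorm_ge0 // rnorm_fst_le.
Qed.

Lemma dsnormZ (r : R) w : dsnorm (r%:C *: w) = `|r| * dsnorm w.
Proof.
rewrite /dsnorm /dsinner /= starZr cmulZl cmulZr innerZl innerZr conjc_real -!scalerDr.
by rewrite !rnormZ mulrA -expr2 sqrtrM ?sqr_ge0 // sqrtr_sqr normr_id.
Qed.

Lemma linking_linear_compress phi b t : 0 < t -> linking_linear phi ->
  linking_linear (phi \o compress b t).
Proof.
move=> t0 phil k S T Sl Tl /=; rewrite -phil; try exact: compress_linking.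
congr phi; apply/funext => w; rewrite /compress /diagop /=; congr (_, _).
  by rewrite cmulDr cmulZr.
by rewrite scalerDr scalerA mulrC -scalerA.
Qed.

(** The compression of [S' S] is the product of [star B . S'] and [S B], which are adjoint to each
    other and lie in the linking algebra. *)
Lemma linking_positive_compress phi b t : 0 < t -> linking_positive phi ->
  linking_positive (phi \o compress b t).
Proof.
move=> t0 phip S S' Sl S'l SS'.
apply: (phip (S \o @diagop R A V b t) (@diagop R A V (star b) t \o S')).
- exact: linking_comp_diagop.
- exact: diagop_comp_linking.
by move=> v w; rewrite /= SS' dsinner_diagop.
Qed.

Lemma linkingZ t S : 0 < t -> linking S -> linking (fun w => t%:C *: S w).
Proof.
move=> t0 [a [x [y [T [Tc ->]]]]].
exists (t%:C *: a), (t%:C *: x), (t%:C *: y), (fun z => t%:C *: T z); split.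
  exact: compact_ops_scale.
apply/funext => w; rewrite /block_op /= /T_ /r_ /l_ cmulZl innerZl conjc_real actZl.
by rewrite -!scalerDr.
Qed.

Lemma linking_scale S k w : linking S -> S (k *: w) = k *: S w.
Proof.
move=> [a [x [y [T [[Ta _] ->]]]]]; rewrite /block_op /= /T_ /r_ /l_.
by rewrite cmulZr innerZr actZr (adjointable_scale _ _ Ta) -!scalerDr.
Qed.

Lemma rnorm_le_fnorm phi (M K : R) S : 0 < K -> linking_linear phi ->
  (linking_fnorm phi <= M%:E)%E -> linking S ->
  (forall w, dsnorm w <= 1 -> dsnorm (S w) <= K) -> rnorm (phi S) <= M * K.
Proof.
move=> K0 phil /linking_fnorm_leP phiM Sl SK.
have Kl := @linkingZ K^-1 S; rewrite invr_gt0 in Kl.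
have := phiM _ (Kl K0 Sl); rewrite linking_linearZ // rnormM rnorm_real gtr0_norm ?invr_gt0 //.
rewrite mulrC ler_pdivrMr //; apply => w w1.
by rewrite dsnormZ gtr0_norm ?invr_gt0 // mulrC ler_pdivrMr // mul1r SK.
Qed.

Lemma linking_fnorm_compress phi b t : rnorm b < t -> linking_linear phi ->
  (linking_fnorm phi <= 1)%E -> (linking_fnorm (phi \o compress b t) <= (t ^+ 2)%:E)%E.
Proof.
move=> bt phil phi1; have t0 : 0 < t := le_lt_trans (rnorm_ge0 _) bt.
have t0' : t%:C != 0 by rewrite eq_complex /= eqxx andbT gt_eqF.
apply/linking_fnorm_leP => S Sl S1 /=; rewrite -[leRHS]mul1r.
apply: rnorm_le_fnorm => //; [by rewrite exprn_gt0|exact: compress_linking|move=> w w1].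
apply: le_trans (dsnorm_diagop _ _) _; first by rewrite rnorm_star.
rewrite expr2 ler_pM2l // /comp.
(* The hypothesis on [S] concerns only the unit ball, so [B w] is written as [t] times the vector
   [B w / t] of norm at most 1. *)
rewrite -[diagop b t w]scale1r -(divff t0') -scalerA (@linking_scale S) // dsnormZ gtr0_norm //.
rewrite ler_piMr ?(ltW t0) //; apply: S1; rewrite -(rmorphV (real_complex R)) /= ?unitfE ?gt_eqF //.
rewrite dsnormZ gtr0_norm ?invr_gt0 // mulrC ler_pdivrMr // mul1r.
by apply: le_trans (dsnorm_diagop _ bt) _; rewrite ler_piMr // ltW.
Qed.

Lemma linking_fnorm_ge0 phi : (0 <= linking_fnorm phi)%E.
Proof.
apply: (@le_trans _ _ (rnorm (phi (fun=> 0)))%:E); first by rewrite lee_fin rnorm_ge0.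
apply: ereal_sup_ubound; exists (fun=> 0) => //; split; first exact: linking0.
apply/opnorm_le1P => w _; rewrite -(scale0r (0 : A * V)) -[0]/(0%:C) dsnormZ.
by rewrite normr0 mul0r.
Qed.

Lemma states_normalize phi (N : R) : 0 < N -> linking_linear phi -> linking_positive phi ->
  linking_fnorm phi = N%:E -> @linking_states R A V (fun S => N^-1%:C * phi S).
Proof.
move=> N0 phil phip phiN; have iN0 : 0 < N^-1 by rewrite invr_gt0.
have normE S : rnorm (phi S) = N * rnorm (N^-1%:C * phi S).
  by rewrite rnormM rnorm_real gtr0_norm // mulVKf // gt_eqF.
split.
- by move=> k S T Sl Tl; rewrite phil // mulrDr mulrCA.
- by move=> S S' Sl S'l SS'; rewrite mulr_ge0 ?ler0c ?(ltW iN0) // phip.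
apply/le_anti/andP; split.
  apply/linking_fnorm_leP => S Sl S1; rewrite -(ler_pM2l N0) -normE mulr1.
  by move: S Sl S1; apply/linking_fnorm_leP; rewrite phiN.
(* If the rescaled functional has norm [m], then [N m] bounds [phi] on the unit ball, so
   [N <= N m]. *)
set M := linking_fnorm _; have : (0 <= M)%E by exact: linking_fnorm_ge0.
case E : M => [m| |]; [| |by rewrite leeNy_eq] => _; last by rewrite leey.
rewrite -[1%E]/(1%:E) lee_fin -(ler_pM2l N0) mulr1 -lee_fin -phiN.
apply/linking_fnorm_leP => S Sl S1; rewrite normE ler_pM2l //.
by move: S Sl S1; apply/linking_fnorm_leP; rewrite -/M E.
Qed.

(** * The numerical radius *)

Let Omega_set x : set R := [set rnorm (phi (lower x)) | phi in @linking_states R A V]%classic.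

Lemma state_lower_le phi (N : R) x : linking_linear phi -> (linking_fnorm phi <= N%:E)%E ->
  rnorm (phi (lower x)) <= N * (rnorm x + 1).
Proof.
move=> phil phiN; apply: rnorm_le_fnorm => //; last 1 first.
- move=> w w1; apply: le_trans (dsnorm_lower _ _) _.
  by rewrite (le_trans (ler_wpM2l (rnorm_ge0 _) w1)) // mulr1 lerDl.
- by rewrite ltr_wpDl ?rnorm_ge0.
- exact: lower_linking.
Qed.

Lemma Omega_ubound x : has_ubound (Omega_set x).
Proof.
exists (1 * (rnorm x + 1)) => _ [phi [phil _ phi1] <-].
by apply: state_lower_le => //; rewrite phi1.
Qed.

Lemma state_le_Omega phi x : linking_states phi -> rnorm (phi (lower x)) <= Omega x.
Proof. by move=> phis; apply: sup_ubound (Omega_ubound x) _ _; exists phi. Qed.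

(** [sup] has the default value 0 on the empty set. This lets [Omega_le] and [Omega_ge0] hold
    without first exhibiting a state. *)
Lemma Omega_set0 x : (forall r, ~ Omega_set x r) -> Omega x = 0.
Proof.
move=> x0; have -> : Omega x = sup (Omega_set x) by [].
by rewrite (_ : Omega_set x = classical_sets.set0) ?sup0 //; apply/seteqP; split => // r /x0.
Qed.

Lemma Omega_le x (M : R) : 0 <= M ->
  (forall phi, linking_states phi -> rnorm (phi (lower x)) <= M) -> Omega x <= M.
Proof.
move=> M0 xM; have [[r xr]|/forallNP x0] := pselect (exists r, Omega_set x r).
  by apply: ge_sup; [exists r|move=> _ [phi phis <-]; exact: xM].
by rewrite Omega_set0 // => r /x0.
Qed.

Lemma Omega_ge0 x : 0 <= Omega x.
Proof.
have [[r xr]|/forallNP x0] := pselect (exists r, Omega_set x r).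
  by case: xr => phi phis _; apply: le_trans (state_le_Omega x phis); exact: rnorm_ge0.
by rewrite Omega_set0 // => r /x0.
Qed.

Lemma state_act_le phi x b t : rnorm b < t -> linking_states phi ->
  rnorm (phi (lower (act x b))) <= t * Omega x.
Proof.
move=> bt [phil phip phi1]; have t0 : 0 < t := le_lt_trans (rnorm_ge0 _) bt.
pose psi := phi \o compress b t.
have psil : linking_linear psi by exact: linking_linear_compress.
have psip : linking_positive psi by exact: linking_positive_compress.
have psiE : rnorm (psi (lower x)) = t * rnorm (phi (lower (act x b))).
  rewrite /psi /= compress_lower linking_linearZ //; last exact: lower_linking.
  by rewrite rnormM rnorm_real gtr0_norm.
have psit : (linking_fnorm psi <= (t ^+ 2)%:E)%E.
  by apply: linking_fnorm_compress => //; rewrite phi1.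
rewrite -(ler_pM2l t0) -psiE mulrA -expr2.
move: (linking_fnorm_ge0 psi) psit; case E : (linking_fnorm psi) => [N| |] //.
rewrite !lee_fin => N0 Nt; have Ox := Omega_ge0 x.
(* A functional of norm zero cannot be normalized to a state, but then [psi] vanishes at
   [lower x]. *)
have [NE|N_neq0] := eqVneq N 0.
  apply: (@le_trans _ _ 0); last by rewrite mulr_ge0 ?exprn_ge0 // ltW.
  by have := @state_lower_le psi 0 x psil; rewrite E NE mul0r; apply.
have Npos : 0 < N by rewrite lt_def N_neq0.
have := state_le_Omega x (states_normalize Npos psil psip E).
rewrite rnormM rnorm_real gtr0_norm ?invr_gt0 // mulrC ler_pdivrMr // => /le_trans; apply.
by rewrite mulrC ler_wpM2r.
Qed.

(** Let [t] decrease to [|b|] in [state_act_le]; the denominator [Omega x + 1] covers the case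
    [Omega x = 0]. *)
Lemma Omega_act x b : Omega (act x b) <= rnorm b * Omega x.
Proof.
have Ox := Omega_ge0 x; apply/ler_addgt0Pr => e e0.
have O1 : 0 < Omega x + 1 by rewrite ltr_wpDl.
have eO : 0 < e / (Omega x + 1) by rewrite divr_gt0.
apply: (@le_trans _ _ ((rnorm b + e / (Omega x + 1)) * Omega x)).
  apply: Omega_le => [|phi phis]; last by apply: state_act_le; rewrite // ltrDl.
  by rewrite mulr_ge0 // addr_ge0 ?rnorm_ge0 // ltW.
rewrite mulrDl lerD2l -mulrA ler_piMr ?(ltW e0) // mulrC ler_pdivrMr // mul1r.
by rewrite lerDl.
Qed.

End Linking.

Theorem mainTheorem6 (R : realType) (A : cstarAlgType R)
  (A_neq0 : exists b : A, b != 0) (V : hilbertModType A) (a : A) (x : V) :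
  Omega (act x a + act x (star a)) <= 2 * rnorm (a + star a) * Omega x
  /\ Omega (act x a - act x (star a)) <= 2 * rnorm (a - star a) * Omega x.
Proof.
(* [Omega_act] gives the estimate with constant 1, which is weakened to 2. *)
have bound b : Omega (act x b) <= 2 * rnorm b * Omega x.
  apply: le_trans (Omega_act x b) _.
  by rewrite ler_wpM2r ?Omega_ge0 // ler_peMl ?rnorm_ge0 // ler1n.
split; first by rewrite -actDr.
by rewrite -(scaleN1r (act x _)) -actZr scaleN1r -actDr.
Qed.
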